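(* $H_{\mathrm{even}}\cap(45000,50000]$ is contained in the thirty-eight-element candidate set \[ \begin{aligned} \{ & 45142, 45286, 45394, 45434, 45478, 45566, 45622, 45706, 45842,\\ & 46022, 46042, 46058, 46394, 46454, 46630, 46714, 46862, 47206,\\ & 47246, 47342, 47378, 47438, 47506, 47858, 47962, 47986, 48086,\\ & 48218, 48338, 48362, 48838, 49354, 49466, 49694, 49834, 49906,\\ & 49958, 49978 \}. \end{aligned} \]
   Context: 3-Higgs primes are defined recursively: $2$ is 3-Higgs; an odd prime $p$ is 3-Higgs if and only if every prime factor $q$ of $p-1$ is a 3-Higgs prime (necessarily $q<p$) and satisfies $v_q(p-1)\le 3$ (including $v_2(p-1)\le 3$), where $v_q$ is the $q$-adic valuation. $H$ is the set of integers $m\ge 1$ such that every prime factor of $2^m+1$ is 3-Higgs, and $H_{\mathrm{even}}=H\cap 2\mathbb{Z}$. *)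

(* Defs.v *)
From mathcomp Require Import all_boot.
Set Implicit Arguments.
Unset Strict Implicit.
Unset Printing Implicit Defensive.

Inductive higgs3 : nat -> Prop :=
| Higgs3_two : higgs3 2
| Higgs3_odd (p : nat) of prime p & odd p
    & (forall q, prime q -> q %| p.-1 -> higgs3 q)
    & (forall q, prime q -> q %| p.-1 -> logn q p.-1 <= 3) : higgs3 p.

Fact higgs3_oddP p : prime p -> odd p ->
  higgs3 p <-> forall q, prime q -> q %| p.-1 -> higgs3 q /\ logn q p.-1 <= 3.
Proof.
move=> p_pr p_odd; split=> [h | h].
  by case: h p_odd => // r _ _ hr vr _ q q_pr qr; split; [apply: hr | apply: vr].
by apply: Higgs3_odd => // q q_pr /(h q q_pr)[].
Qed.

Definition H (m : nat) : Prop :=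
  0 < m /\ forall p, prime p -> p %| 2 ^ m + 1 -> higgs3 p.

Definition Heven (m : nat) : Prop := H m /\ 2 %| m.

#[local] Set Warnings "-abstract-large-number".

Definition candidates : seq nat :=
  [:: 45142; 45286; 45394; 45434; 45478; 45566; 45622; 45706; 45842;
      46022; 46042; 46058; 46394; 46454; 46630; 46714; 46862; 47206;
      47246; 47342; 47378; 47438; 47506; 47858; 47962; 47986; 48086;
      48218; 48338; 48362; 48838; 49354; 49466; 49694; 49834; 49906;
      49958; 49978].

Fact uniq_candidates : uniq candidates.
Proof. by apply: (sorted_uniq ltn_trans ltnn); vm_compute. Qed.

Fact size_candidates : size candidates = 38.
Proof. by []. Qed.

(* Main.v *)
Require Import Defs.
From Stdlib Require Import Arith PArith NArith.
#[local] Set Warnings "-notation-overridden".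
From mathcomp Require Import all_boot cyclic zify.

(** An even [m] can only belong to [H] if [2 ^ m + 1] has no prime factor
    outside the 3-Higgs primes, so every [m] outside the candidate list needs
    one such factor.  It comes from one of three sources.

    If [4 %| m], there is always one: for [8 %| m] every prime factor [r] of
    [2 ^ m + 1] has [2 ^ 4 %| r.-1], and for [m] an odd multiple of 4 the prime
    17 divides [2 ^ m + 1] ([not_H_dvd4]).

    Otherwise [m = 2 * n] with [n] odd, and [2 ^ m + 1 = 4 ^ n + 1].  A prime
    factor [r] other than 5 of [4 ^ s + 1], with [s] prime, satisfies
    [r = 1 %[mod s]].  Hence, if [n] has a divisor [s > 1] without 3-Higgs prime
    factors, then [(4 ^ s + 1) %/ 5], which divides [4 ^ n + 1], has none either
    ([higgs3_free_exponent]).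

    For the remaining [n], a divisor [d] of [n] and an explicit factor [p] of
    [4 ^ d + 1], which divides [4 ^ n + 1] because [n %/ d] is odd, are listed
    in a table.  These factors were found by trial division and by the elliptic
    curve method; they have up to 29 digits.

    That a large [p] is not 3-Higgs is shown by a chain [p, q, q', q'', ...] in
    which each term divides its predecessor minus one, and whose last term has
    its fourth power dividing its predecessor minus one.  Proving that the terms
    are primes would be the expensive part, and it is avoided: the property
    carried along the chain is [higgs3_free], that no prime factor is 3-Higgs.
    It goes from [q] to [p] by the congruence in Pocklington's criterion, since
    [a ^ p.-1 = 1 %[mod p]] and [gcdn (a ^ (p.-1 %/ q) - 1) p = 1] force every
    prime factor [r] of [p] to satisfy [s %| r.-1] for some prime factor [s] of
    [q] ([pocklington_logn], [higgs3_free_step]).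

    All the chains are merged in one increasing table, which is checked in
    binary arithmetic by computation. *)

Set Implicit Arguments.
Unset Strict Implicit.
Unset Printing Implicit Defensive.

(** * Numbers without 3-Higgs prime factors *)

Definition higgs3_free (N : nat) : Prop :=
  forall r, prime r -> r %| N -> ~ higgs3 r.

Lemma higgs3_dvd_pred r q : prime r -> higgs3 r -> prime q -> q %| r.-1 ->
  higgs3 q /\ logn q r.-1 <= 3.
Proof.
move=> r_pr hr q_pr qr; have [r2 | r_odd] := even_prime r_pr.
  by move: qr q_pr; rewrite r2 dvdn1 => /eqP->.
by have [h _] := higgs3_oddP r_pr r_odd; apply: h.
Qed.

Lemma higgs3_free17 : higgs3_free 17.
Proof.
move=> r r_pr; rewrite dvdn_prime2 // => /eqP-> h.
by have [] := @higgs3_dvd_pred 17 2 isT h isT isT.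
Qed.

Lemma higgs3_5 : higgs3 5.
Proof.
have div4 q : prime q -> q %| 5.-1 -> q = 2.
  move=> q_pr; rewrite -[5.-1]/(2 ^ 2) Euclid_dvdX // andbT.
  by rewrite dvdn_prime2 // => /eqP.
by apply: Higgs3_odd => // q q_pr /(div4 q q_pr) -> //; exact: Higgs3_two.
Qed.

Lemma not_H_of_factor m p : 1 < p -> higgs3_free p -> p %| 2 ^ m + 1 -> ~ H m.
Proof.
move=> p_gt1 p_free pm [_ Hm]; apply: (p_free (pdiv p)).
- exact: pdiv_prime.
- exact: pdiv_dvd.
apply: Hm; first exact: pdiv_prime.
exact: dvdn_trans (pdiv_dvd p) pm.
Qed.

(** * The congruence in Pocklington's criterion *)

Lemma expn_eq1_gcdn a x y r : 0 < x ->
  a ^ x = 1 %[mod r] -> a ^ y = 1 %[mod r] -> a ^ gcdn x y = 1 %[mod r].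
Proof.
move=> x_gt0 ax ay; case: (egcdnP y x_gt0) => u v uv _.
have pow1 z w : a ^ z = 1 %[mod r] -> a ^ (w * z) = 1 %[mod r].
  by move=> az; rewrite mulnC expnM -modnXm az modnXm exp1n.
have := pow1 x u ax; rewrite uv expnD -modnMml pow1 // modnMml mul1n.
exact.
Qed.

Lemma expn_pred_prime_eq1 a x r : prime r -> 0 < x -> a ^ x = 1 %[mod r] ->
  a ^ r.-1 = 1 %[mod r].
Proof.
move=> r_pr x_gt0 ax; rewrite -totient_prime //; apply: Euler_exp_totient.
rewrite coprime_sym prime_coprime //; apply/negP=> ra.
have : r %| a ^ x by rewrite Euclid_dvdX // ra.
by rewrite /dvdn ax modn_small ?prime_gt1.
Qed.

(** The order of [a] modulo [r] divides [g = gcdn (q * M) r.-1] but not [M], so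
    some prime [s] occurs more often in [g] than in [M]; since [g] divides
    [q * M], that prime divides [q].  Neither [q] nor [q * M] plus one has to be
    prime, which is what makes unproved factors usable. *)
Lemma pocklington_logn (a q M r : nat) :
    prime r -> 0 < q * M -> a ^ (q * M) = 1 %[mod r] -> a ^ M <> 1 %[mod r] ->
  exists s, [/\ prime s, s %| q & logn s M < logn s r.-1].
Proof.
move=> r_pr qM_gt0 aqM aM.
have [q_gt0 M_gt0] : 0 < q /\ 0 < M by apply/andP; rewrite -muln_gt0.
have ar := expn_pred_prime_eq1 r_pr qM_gt0 aqM.
have ag := expn_eq1_gcdn qM_gt0 aqM ar.
set g := gcdn _ _ in ag.
have g_gt0 : 0 < g by rewrite gcdn_gt0 qM_gt0.
have r1_gt0 : 0 < r.-1 by rewrite -subn1 subn_gt0 prime_gt1.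
have gM : ~~ (g %| M).
  apply/negP=> /dvdnP[k Mk]; apply: aM.
  by rewrite Mk mulnC expnM -modnXm ag modnXm exp1n.
have /allPn[s] : ~~ all (fun p : nat => g`_p %| M) (primes g).
  by apply: contra gM => /allP gM; apply/dvdn_partP.
rewrite mem_primes => /and3P[s_pr _ _] s_gM.
have sM : logn s M < logn s g by rewrite ltnNge -pfactor_dvdn // -p_part.
exists s; split=> //; last by rewrite (leq_trans sM) // dvdn_leq_log ?dvdn_gcdr.
have : logn s g <= logn s (q * M) by rewrite dvdn_leq_log ?dvdn_gcdl.
rewrite lognM // => /(leq_trans sM); rewrite -{1}[logn s M]add0n ltn_add2r.
by rewrite logn_gt0 mem_primes => /and3P[].
Qed.

(** The two alternatives are the two ways in which the prime [s] given by
    [pocklington_logn] can contradict that [r] is 3-Higgs: [s] is not 3-Higgs,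
    or, when [q ^ 4] divides [N.-1], [s ^ 4] divides [r.-1]. *)
Lemma higgs3_free_step (a q M N : nat) : 0 < q * M -> N = (q * M).+1 ->
    a ^ (q * M) = 1 %[mod N] ->
    (forall r, prime r -> r %| N -> a ^ M <> 1 %[mod r]) ->
    higgs3_free q \/ q ^ 3 %| M ->
  higgs3_free N.
Proof.
move=> qM_gt0 defN aN aM q_free r r_pr rN r_higgs.
have ar : a ^ (q * M) = 1 %[mod r] by rewrite -(modn_dvdm _ rN) aN modn_dvdm.
have [s [s_pr sq sM]] := pocklington_logn r_pr qM_gt0 ar (aM r r_pr rN).
have s_r1 : s %| r.-1.
  have := leq_ltn_trans (leq0n _) sM.
  by rewrite logn_gt0 mem_primes => /and3P[].
have [s_higgs logs] := higgs3_dvd_pred r_pr r_higgs s_pr s_r1.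
have [M_gt0 q_gt0] : 0 < M /\ 0 < q by apply/andP; rewrite andbC -muln_gt0.
case: q_free => [/(_ s s_pr sq)//|qM].
suff M3 : 3 <= logn s M by have := leq_trans sM logs; rewrite ltnNge M3.
apply: leq_trans (dvdn_leq_log s M_gt0 qM).
by rewrite lognX leq_pmulr // logn_gt0 mem_primes s_pr q_gt0.
Qed.

(** * Divisors of the exponent *)

Lemma dvdn_expn_odd_add1 b k : odd k -> b + 1 %| b ^ k + 1.
Proof.
move=> k_odd; rewrite -[k]odd_double_half k_odd; elim: k./2 => [|j IH].
  by rewrite expn1.
case: b IH => [|b] IH; first by rewrite dvd1n.
have : b.+1 + 1 %| (b.+1 + 1) * b by rewrite dvdn_mulr.
move/dvdn_addl <-.
have -> : b.+1 ^ (true + j.+1.*2) + 1 + (b.+1 + 1) * b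
          = (b.+1 ^ (true + j.*2) + 1) * b.+1 ^ 2.
  by rewrite doubleS !addnS !expnS; nia.
by rewrite dvdn_mulr.
Qed.

Lemma dvdn_expn4_add1 d n : odd n -> d %| n -> 4 ^ d + 1 %| 2 ^ (2 * n) + 1.
Proof.
move=> n_odd /dvdnP[k nk].
rewrite expnM nk mulnC expnM dvdn_expn_odd_add1 //.
by move: n_odd; rewrite nk oddM => /andP[].
Qed.

(** Expanding [(5 - 1) ^ s + 1] to first order in 5; it shows that the cofactor
    [(4 ^ s + 1) %/ 5] is prime to 5 unless [s] is a multiple of 5. *)
Lemma expn4_add1_mod25 s : odd s -> (4 ^ s + 1) %% 25 = (5 * s) %% 25.
Proof.
move=> s_odd; rewrite -[s]odd_double_half s_odd; elim: s./2 => // j IH.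
have pow4 : 4 ^ (true + j.+1.*2) + 1 + 15 = 16 * (4 ^ (true + j.*2) + 1).
  by rewrite doubleS !addnS !expnS; nia.
apply/eqP; rewrite -(eqn_modDr 15) pow4 -modnMmr IH modnMmr.
have -> : 16 * (5 * (true + j.*2))
          = (2 + 6 * j) * 25 + (5 * (true + j.+1.*2) + 15) by lia.
by rewrite modnMDl.
Qed.

(** For a prime factor [r] of [4 ^ s + 1], [16 ^ s = 1 %[mod r]], and
    [16 = 1 %[mod r]] only for [r] in [[:: 3; 5]].  The prime 3 does not divide
    [4 ^ s + 1], and dividing by 5 removes the only factor 5, because the
    3-Higgs prime 5 does not divide [s].  Thus [pocklington_logn] applies. *)
Lemma higgs3_free_exponent s : 1 < s -> odd s -> higgs3_free s ->
  higgs3_free ((4 ^ s + 1) %/ 5).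
Proof.
move=> s_gt1 s_odd s_free r r_pr r_dvd r_higgs.
have five_dvd : 5 %| 4 ^ s + 1 by exact: (dvdn_expn_odd_add1 4 s_odd).
have r_dvd4 : r %| 4 ^ s + 1 by rewrite -(divnK five_dvd) dvdn_mulr.
have r16s : 16 ^ (s * 1) = 1 %[mod r].
  rewrite muln1 -[16]/(4 ^ 2) -expnM mulnC expnM; apply/eqP.
  rewrite eqn_mod_dvd ?expn_gt0 ?expn_gt0 // -[1]/(1 ^ 2) subn_sqr.
  by rewrite dvdn_mull.
have r16 : 16 ^ 1 <> 1 %[mod r].
  move/eqP; rewrite eqn_mod_dvd // -[_ - _]/(3 * 5) Euclid_dvdM //.
  rewrite !dvdn_prime2 // => /orP[]/eqP r_eq; move: r_dvd4 r_dvd; rewrite r_eq.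
    by rewrite /dvdn -modnDml -modnXm exp1n.
  rewrite dvdn_divRL // => _ s25.
  suff /s_free : 5 %| s by apply => //; exact: higgs3_5.
  rewrite -(@dvdn_pmul2l 5) //; move: s25.
  by rewrite /dvdn expn4_add1_mod25.
have s1_gt0 : 0 < s * 1 by rewrite muln1 ltnW.
have [q [q_pr qs]] := pocklington_logn r_pr s1_gt0 r16s r16.
rewrite logn1 logn_gt0 mem_primes => /and3P[_ _ q_r1].
by have [/(s_free q q_pr qs)] := higgs3_dvd_pred r_pr r_higgs q_pr q_r1.
Qed.

Lemma not_H_of_exponent n s : odd n -> 1 < s -> higgs3_free s -> s %| n ->
  ~ H (2 * n).
Proof.
move=> n_odd s_gt1 s_free sn.
have s_odd : odd s by case/dvdnP: sn n_odd => k ->; rewrite oddM => /andP[].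
apply: not_H_of_factor (higgs3_free_exponent s_gt1 s_odd s_free) _.
  by rewrite leq_divRL // (@leq_trans (4 ^ 2 + 1)) // leq_add2r leq_exp2l.
apply: dvdn_trans (dvdn_expn4_add1 n_odd sn).
by rewrite dvdn_div //; exact: (dvdn_expn_odd_add1 4 s_odd).
Qed.

(** For [m = 8 * j], [a = 2 ^ j] has [a ^ 8 = -1] modulo every prime factor of
    [2 ^ m + 1], hence order 16.  For [m = 4 * j] with [j] odd, [16 + 1] divides
    [16 ^ j + 1]. *)
Lemma not_H_dvd4 m : 4 %| m -> ~ H m.
Proof.
move=> m4 Hm; have m_gt0 : 0 < m by case: Hm.
have [m8 | m8] := boolP (8 %| m).
  apply: (@not_H_of_factor m (2 ^ m + 1)) Hm; rewrite ?dvdnn //.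
    by rewrite addn1 ltnS expn_gt0.
  move=> r r_pr r_dvd r_higgs.
  have r_neq2 : r != 2.
    apply: contraTneq r_dvd => ->.
    by rewrite dvdn2 oddD oddX negbK -leqn0 leqNgt m_gt0.
  case/dvdnP: m8 r_dvd => j ->; rewrite expnM; set a := 2 ^ j => r_dvd.
  have a16 : a ^ (2 * 2 ^ 3) = 1 %[mod r].
    apply/eqP; rewrite mulnC expnM eqn_mod_dvd ?expn_gt0 ?expn_gt0 //.
    by rewrite -[1]/(1 ^ 2) subn_sqr dvdn_mull.
  have a8 : a ^ (2 ^ 3) <> 1 %[mod r].
    move=> a8; move: r_dvd; rewrite /dvdn -modnDml a8 modnDml => r2.
    by move: r_neq2; rewrite -(dvdn_prime2 r_pr) // /dvdn r2.
  have [s [s_pr]] := @pocklington_logn a 2 (2 ^ 3) r r_pr isT a16 a8.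
  rewrite dvdn_prime2 // => /eqP->; rewrite pfactorK // => log2.
  have [|_] := @higgs3_dvd_pred r 2 r_pr r_higgs isT.
    have := leq_ltn_trans (leq0n _) log2.
    by rewrite logn_gt0 mem_primes => /and3P[].
  by rewrite leqNgt log2.
case/dvdnP: m4 m8 Hm => j -> j_odd Hm.
apply: (not_H_of_factor _ higgs3_free17) Hm => //.
rewrite mulnC expnM (dvdn_expn_odd_add1 16) //.
by move: j_odd; rewrite -[8]/(2 * 4) dvdn_pmul2r // dvdn2 negbK.
Qed.

(** * Checking certificates in binary arithmetic *)

Definition powmod (a n e : N) : N :=
  let fix pow e := match e with
    | xH => N.modulo a n
    | xO e' => let b := pow e' in N.modulo (b * b) n
    | xI e' => let b := pow e' in N.modulo (N.modulo (b * b) n * a) n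
    end in
  if e is Npos e' then pow e' else N.modulo 1 n.

Lemma N_to_nat_mod (x n : N) :
  N.to_nat (N.modulo x n) = N.to_nat x %% N.to_nat n.
Proof.
rewrite N2Nat.inj_mod; case: (N.to_nat n) (N.to_nat x) => [|b] a.
  by rewrite modn0.
have lt_mod : PeanoNat.Nat.modulo a b.+1 < b.+1.
  by apply/ltP; apply: PeanoNat.Nat.mod_upper_bound.
rewrite {2}(PeanoNat.Nat.div_mod_eq a b.+1) plusE multE mulnC modnMDl.
by rewrite modn_small.
Qed.

Lemma N_to_nat_mul (x y : N) : N.to_nat (x * y) = N.to_nat x * N.to_nat y.
Proof. exact: N2Nat.inj_mul. Qed.

Lemma N_to_nat_powmod a n e :
  N.to_nat (powmod a n e) = N.to_nat a ^ N.to_nat e %% N.to_nat n.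
Proof.
case: e => [|e]; first by rewrite N_to_nat_mod.
rewrite /powmod; elim: e => [e IH|e IH|]; last by rewrite N_to_nat_mod expn1.
  rewrite N_to_nat_mod N_to_nat_mul N_to_nat_mod N_to_nat_mul IH.
  rewrite modnMm modnMml -expnD addnn -expnSr /=.
  by rewrite Pos2Nat.inj_xI multE mul2n.
rewrite N_to_nat_mod N_to_nat_mul IH modnMm -expnD addnn /=.
by rewrite Pos2Nat.inj_xO multE mul2n.
Qed.

Lemma N_modulo_dvdn n d : N.modulo n d = 0%num -> N.to_nat d %| N.to_nat n.
Proof. by move=> nd; rewrite /dvdn -N_to_nat_mod nd. Qed.

Lemma N_gcd1_dvdn x y r : N.gcd x y = 1%num ->
  r %| N.to_nat x -> r %| N.to_nat y -> r = 1.
Proof.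
move=> gcd1.
have N_divide z : r %| N.to_nat z -> N.divide (N.of_nat r) z.
  case/dvdnP=> k zk; exists (N.of_nat k).
  by rewrite -[z]N2Nat.id zk -multE Nat2N.inj_mul.
move=> /N_divide rx /N_divide ry.
have := N.gcd_greatest _ _ _ rx ry; rewrite gcd1 => /N.divide_1_r r1.
by rewrite -[r]Nat2N.id r1.
Qed.

(** For primes [n] and [q], a base [a] works when it is not a [q]-th power
    modulo [n], so that a few small candidates suffice.  Adding [N.pred n] is subtracting 1 modulo [n] without
    truncation. *)
Definition step_ok (known : seq N) (n q : N) : bool :=
  let M := N.div (N.pred n) q in
  [&& N.ltb 1 n, N.eqb (q * M) (N.pred n),
      N.eqb (N.modulo M (q * q * q)) 0 || has (N.eqb q) known
    & has (fun a => let x := powmod a n M in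
             N.eqb (powmod x n q) 1 && N.eqb (N.gcd (x + N.pred n) n) 1)
          [:: 2; 3; 5; 7; 11; 13; 17; 19; 23; 29; 31]%num].

Definition all_higgs3_free (known : seq N) : Prop :=
  forall s, s \in known -> higgs3_free (N.to_nat s).

Lemma step_ok_higgs3_free known n q :
  all_higgs3_free known -> step_ok known n q -> higgs3_free (N.to_nat n).
Proof.
move=> known_free /and4P[/N.ltb_lt n_gt1 /N.eqb_eq nM q_ok /hasP[a _ /andP[]]].
set M := N.div _ _ in nM q_ok *; set x := powmod a n M.
move=> /N.eqb_eq xq /N.eqb_eq gcd1.
have {}n_gt1 : 1 < N.to_nat n by lia.
have pred_n : N.to_nat q * N.to_nat M = (N.to_nat n).-1.
  by rewrite -N_to_nat_mul nM N2Nat.inj_pred.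
apply: (@higgs3_free_step (N.to_nat a) (N.to_nat q) (N.to_nat M)).
- by rewrite pred_n; lia.
- by rewrite pred_n prednK // ltnW.
- rewrite mulnC expnM -modnXm -N_to_nat_powmod -/x -N_to_nat_powmod xq.
  by rewrite modn_small.
- move=> r r_pr rn aM; suff r1 : r = 1 by rewrite r1 in r_pr.
  apply: (N_gcd1_dvdn gcd1) => //.
  rewrite N2Nat.inj_add plusE N2Nat.inj_pred /dvdn -modnDml N_to_nat_powmod.
  by rewrite modn_dvdm // aM modnDml add1n prednK ?(eqP rn) // ltnW.
case/orP: q_ok => [/N.eqb_eq M0 | /hasP[s s_known /N.eqb_eq->]].
  right; have /(congr1 N.to_nat) := M0.
  by rewrite N_to_nat_mod !N_to_nat_mul -!mulnA => Mq; apply/eqP.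
by left; apply: known_free.
Qed.

Fixpoint steps_ok (known : seq N) (steps : seq (N * N)) : bool :=
  if steps is (n, q) :: steps' then
    step_ok known n q && steps_ok (n :: known) steps'
  else true.

Lemma steps_ok_higgs3_free known steps :
    all_higgs3_free known -> steps_ok known steps ->
  all_higgs3_free [seq s.1 | s <- steps].
Proof.
elim: steps known => [|[n q] steps IH] known known_free //= /andP[nq_ok ok] s.
have n_free := step_ok_higgs3_free known_free nq_ok.
rewrite inE => /orP[/eqP-> // | ]; apply: IH ok _.
by move=> t; rewrite inE => /orP[/eqP-> // | /known_free].
Qed.

(** [powmod 4 p d = -1] says that [p] divides [4 ^ d + 1]. *)
Definition factor_ok (known : seq N) (w : N * N) : bool :=
  let: (d, p) := w in
  [&& N.ltb 1 p, has (N.eqb p) known & N.eqb (powmod 4 p d) (N.pred p)].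

Definition excluded (known : seq N) (factors : seq (N * N)) (n : N) : bool :=
  has (fun s => N.ltb 1 s && N.eqb (N.modulo n s) 0) known
  || has (fun w => N.eqb (N.modulo n w.1) 0) factors.

Lemma excluded_not_H known factors n :
    all_higgs3_free known -> all (factor_ok known) factors ->
    odd (N.to_nat n) -> excluded known factors n ->
  ~ H (2 * N.to_nat n).
Proof.
move=> known_free ok n_odd /orP[/hasP[s s_known /andP[]] | /hasP[[d p]]].
  move=> /N.ltb_lt s_gt1 /N.eqb_eq /N_modulo_dvdn; apply: not_H_of_exponent.
  - by [].
  - by lia.
  - exact: known_free.
move=> /(allP ok)/and3P[/N.ltb_lt p_gt1 /hasP[x x_known /N.eqb_eq p_x]].
have p_known : p \in known by rewrite p_x.
move=> /N.eqb_eq pd /N.eqb_eq/N_modulo_dvdn dn.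
apply: not_H_of_factor (known_free p p_known) _; first by lia.
apply: dvdn_trans (dvdn_expn4_add1 n_odd dn).
have p_gt0 : 0 < N.to_nat p by lia.
have := congr1 N.to_nat pd; rewrite N_to_nat_powmod N2Nat.inj_pred => pow4d.
by rewrite /dvdn -modnDml pow4d addn1 prednK // modnn.
Qed.

(** The even [m] that are not multiples of 4 are the [2 * n] with [n] odd; the
    ones in the interval are those with [n = 2 * a + 1 + 2 * j], [j < 1250]. *)
Lemma Heven_mem_of_tables (a : N) steps factors (cands : seq N) :
    steps_ok [::] steps ->
    all (factor_ok [seq s.1 | s <- steps]) factors ->
    all (fun n => has (N.eqb (2 * n)) cands
                  || excluded [seq s.1 | s <- steps] factors n)
        [seq (2 * a + 1 + 2 * N.of_nat j)%num | j <- iota 0 1250] ->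
  forall m, Heven m -> 4 * N.to_nat a < m <= 4 * N.to_nat a + 5000 ->
    m \in [seq N.to_nat c | c <- cands].
Proof.
move=> steps_okn factors_ok cov m [Hm m2] /andP[m_gt m_le].
have [m4|m4] := boolP (4 %| m); first by case: (not_H_dvd4 m4 Hm).
have known_free : all_higgs3_free [seq s.1 | s <- steps].
  by apply: steps_ok_higgs3_free steps_okn.
have [n0 m_eq] := dvdnP m2.
have n0_odd : odd n0.
  by move: m4; rewrite m_eq -[4]/(2 * 2) dvdn_pmul2r // dvdn2 negbK.
have n0_half := odd_double_half n0; rewrite n0_odd in n0_half.
pose j := n0./2 - N.to_nat a.
have mj : m = 2 * (2 * N.to_nat a + 1 + 2 * j) by rewrite /j; lia.
have jlt : j \in iota 0 1250 by rewrite mem_iota /j; lia.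
pose n := (2 * a + 1 + 2 * N.of_nat j)%num.
have n_in : n \in [seq (2 * a + 1 + 2 * N.of_nat j)%num | j <- iota 0 1250].
  by apply/mapP; exists j.
have nE : N.to_nat n = 2 * N.to_nat a + 1 + 2 * j.
  by rewrite /n !N2Nat.inj_add !N2Nat.inj_mul Nat2N.id.
have m_n : m = 2 * N.to_nat n := etrans mj (congr1 (muln 2) (esym nE)).
have n_odd : odd (N.to_nat n) by rewrite nE; clear; lia.
case/orP: (allP cov n n_in) => [/hasP[c c_in /N.eqb_eq nc] | n_excl].
  by apply/mapP; exists c => //; rewrite -nc m_n; exact/esym/N_to_nat_mul.
by case: (excluded_not_H known_free factors_ok n_odd n_excl); rewrite -m_n.
Qed.

(** * The tables *)

(** The pairs [(n, q)] of the chains, in increasing order, so that each [q]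
    either comes earlier as a first component or has [q ^ 4] dividing [n - 1].
    A first
    component dividing [m %/ 2] excludes [m] by itself. *)
Definition chain_steps : seq (N * N) :=
  [:: (17, 2); (97, 2); (103, 17); (113, 2); (137, 17); (163, 3); (193, 2);
      (227, 113); (239, 17); (241, 2); (257, 2); (307, 17); (337, 2);
      (353, 2); (389, 97); (401, 2); (409, 17); (433, 2); (443, 17);
      (449, 2); (479, 239); (487, 3); (577, 2); (593, 2); (613, 17);
      (641, 2); (647, 17); (653, 163); (673, 2); (769, 2); (773, 193);
      (811, 3); (823, 137); (881, 2); (887, 443); (953, 17);
      (971, 97); (977, 2); (1009, 2); (1021, 17); (1031, 103);
      (1123, 17); (1187, 593); (1201, 2); (1229, 307); (1249, 2);
      (1259, 17); (1283, 641); (1327, 17); (1361, 2); (1531, 17);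
      (1543, 257); (1553, 2); (1583, 113); (1601, 2); (1621, 3);
      (1637, 409); (1667, 17); (1733, 433); (1747, 97); (1777, 2);
      (1783, 3); (1871, 17); (1873, 2); (1889, 2); (1907, 953);
      (1913, 239); (1931, 193); (1973, 17); (2017, 2); (2063, 1031);
      (2081, 2); (2113, 2); (2269, 3); (2273, 2); (2417, 2);
      (2459, 1229); (2467, 137); (2551, 17); (2593, 2); (2609, 2);
      (2657, 2); (2659, 443); (2687, 17); (2689, 2); (2693, 673);
      (2713, 113); (2741, 137); (2753, 2); (2801, 2); (2857, 17);
      (3041, 2); (3163, 17); (3217, 2); (3313, 2); (3469, 17);
      (3761, 2); (3779, 1889); (3863, 1931); (3911, 17); (4001, 2);
      (4091, 409); (4127, 2063); (4463, 97); (4513, 2); (4523, 17);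
      (4547, 2273); (4561, 2); (4591, 17); (4639, 773); (4657, 2);
      (4673, 2); (4721, 2); (4801, 2); (4813, 401); (4817, 2);
      (4861, 3); (4871, 487); (4909, 409); (4919, 2459); (4931, 17);
      (4933, 137); (4943, 353); (4973, 113); (4993, 2); (4999, 17);
      (5827, 971); (5849, 17); (5953, 2); (6131, 613); (6203, 443);
      (7523, 3761); (7537, 2); (7549, 17); (7559, 3779); (7583, 17);
      (7649, 2); (7673, 137); (7681, 2); (7691, 769); (7699, 1283);
      (7727, 3863); (7753, 17); (7793, 2); (7817, 977); (7823, 3911);
      (7829, 103); (7841, 2); (7873, 2); (7937, 2); (7963, 1327);
      (8017, 2); (8059, 17); (8069, 2017); (8081, 2); (8089, 337);
      (8093, 17); (8101, 3); (8111, 811); (8161, 2); (8167, 1361);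
      (8209, 2); (8221, 137); (8231, 823); (8263, 3); (8273, 2);
      (8297, 17); (8609, 2); (9011, 17); (9929, 17); (10193, 2);
      (10477, 97); (11393, 2); (11519, 443); (11699, 5849);
      (11783, 137); (12011, 1201); (12253, 1021); (12263, 6131);
      (15559, 2593); (15761, 2); (15809, 2); (19841, 2); (20333, 17);
      (21149, 17); (22501, 5); (22543, 17); (22567, 3761);
      (22669, 1889); (22679, 17); (22691, 2269); (22699, 97);
      (22709, 811); (22721, 2); (22769, 2); (22787, 11393);
      (22817, 2); (22907, 881); (22961, 2); (22993, 2); (23017, 137);
      (23039, 11519); (23041, 2); (23053, 17); (23057, 2);
      (23063, 887); (23071, 769); (23081, 577); (23087, 17);
      (23131, 257); (23167, 3); (23173, 1931); (23189, 17);
      (23201, 2); (23279, 103); (23291, 17); (23293, 647); (23297, 2);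
      (23333, 307); (23339, 1667); (23399, 11699); (23473, 2);
      (23509, 653); (23537, 2); (23563, 17); (23567, 11783);
      (23609, 227); (23633, 2); (23669, 97); (23677, 1973);
      (23741, 1187); (23761, 2); (23767, 17); (23801, 17);
      (23813, 5953); (23857, 2); (23869, 17); (23873, 2);
      (23887, 1327); (23957, 113); (23971, 17); (23977, 3);
      (24001, 2); (24007, 4001); (24023, 12011); (24049, 2);
      (24061, 401); (24097, 2); (24103, 103); (24107, 17); (24113, 2);
      (24229, 673); (24247, 449); (24251, 97); (24329, 3041);
      (24337, 2); (24359, 641); (24379, 17); (24413, 17); (24481, 2);
      (24499, 1361); (24517, 227); (24527, 12263); (24547, 4091);
      (24593, 2); (24671, 2467); (24691, 823); (24763, 4127);
      (24809, 443); (24821, 17); (24889, 17); (24907, 593);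
      (24923, 17); (24971, 227); (24977, 2); (25409, 2); (25793, 2);
      (26417, 2); (26513, 2); (30781, 3); (31013, 7753); (37201, 2);
      (37619, 2687); (39499, 227); (42569, 17); (42737, 2);
      (42841, 17); (47137, 2); (47569, 2); (48757, 17); (52879, 1259);
      (54001, 2); (54721, 2); (55889, 2); (58337, 2); (58453, 4871);
      (62501, 5); (69661, 3); (73951, 17); (74353, 2); (75217, 2);
      (75239, 37619); (83761, 2); (86257, 2); (86753, 2); (88657, 2);
      (93761, 2); (119057, 2); (121789, 17); (125003, 62501);
      (125617, 2); (126473, 15809); (127217, 2); (132689, 2);
      (140617, 3); (150497, 2); (154873, 3); (157649, 2);
      (168781, 97); (172801, 2); (176123, 823); (184687, 30781);
      (195029, 48757); (207877, 17); (239461, 307); (246241, 2);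
      (247781, 953); (257189, 113); (266081, 2); (284369, 2);
      (299329, 2); (305873, 2); (325517, 17); (360593, 2);
      (360817, 2); (365137, 2); (372497, 2); (373489, 2); (374321, 2);
      (375281, 2); (377297, 2); (379889, 2); (392593, 2); (399473, 2);
      (495563, 247781); (500177, 2); (514093, 42841); (516053, 17);
      (525313, 2); (527809, 2); (529649, 2); (544613, 17);
      (585889, 2); (603761, 2); (611441, 2); (631937, 2); (668513, 2);
      (734113, 2); (742817, 2); (761249, 2); (779873, 2); (780961, 2);
      (782113, 2); (786337, 2); (805873, 2); (852881, 2);
      (991127, 495563); (1037297, 2); (1085809, 2); (1100977, 2);
      (1126033, 2); (1134193, 2); (1157713, 2); (1172497, 2);
      (1182289, 2); (1370519, 103); (1408349, 17); (1501889, 2);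
      (1513441, 2); (1523393, 2); (1529537, 2); (1567661, 103);
      (1573997, 17); (1686907, 3); (1727051, 2657); (1749089, 2);
      (1799153, 2); (1913201, 2); (1974641, 2); (2037689, 17);
      (2050817, 2); (2127617, 2); (2167873, 2); (2220919, 52879);
      (2244769, 2); (2259199, 17); (2288249, 103); (2381473, 2);
      (2384497, 2); (2696633, 113); (2885249, 2); (2939977, 3);
      (3082543, 17); (3295729, 2); (3511441, 2); (3643681, 2);
      (3802081, 2); (3951841, 2); (4105553, 2); (4294237, 449);
      (4545521, 2); (4613569, 2); (4910141, 97); (5080081, 2);
      (5128657, 2); (5368609, 2); (5459789, 17); (5534597, 307);
      (5575597, 103); (5614321, 2); (5702297, 443); (5796361, 3);
      (5826173, 17); (5964241, 2); (6194921, 154873); (6638773, 17);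
      (7563841, 2); (7584961, 2); (7755889, 2); (7893649, 2);
      (8226593, 2); (8323793, 2); (8385397, 257); (8392897, 2);
      (9165797, 55889); (9244877, 97); (9293017, 17); (9478801, 2);
      (9797773, 103); (9834443, 97); (13063537, 2); (13302229, 17);
      (13488737, 2); (13642561, 2); (14804429, 449); (14815397, 163);
      (15358129, 2); (17795689, 163); (18486649, 97); (18745393, 2);
      (19362029, 433); (19509937, 2); (19883057, 2); (19994449, 2);
      (20119441, 2); (21607613, 17); (22000109, 17); (22548473, 113);
      (23769233, 2); (25705489, 2); (28256399, 239461);
      (30468149, 17); (30468577, 2); (32575469, 17); (33169333, 1031);
      (33458933, 103); (33810961, 2); (35498653, 17);
      (36198653, 184687); (36835441, 2); (39529621, 3); (43662721, 2);
      (45185797, 17); (47441281, 2); (47577889, 2); (49459577, 5827);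
      (51185137, 2); (62629153, 2); (64120997, 3469); (68244529, 2);
      (76648633, 1249); (76788721, 2); (86396977, 2); (87398029, 3);
      (95768689, 2); (97139501, 1123); (102676417, 2);
      (102733517, 17); (107367629, 113); (111650629, 17);
      (118785757, 433); (127489793, 2); (137778001, 2);
      (142543777, 2); (148587949, 953); (163866977, 2);
      (170756297, 17); (175339889, 2); (183102481, 2);
      (187077497, 257); (216779377, 2); (220706077, 769);
      (250333777, 2); (260683037, 239); (269665073, 2);
      (278904161, 2); (288326429, 3163); (289427953, 2);
      (290169757, 971); (294407497, 17); (308635049, 1667);
      (313549141, 647); (336357673, 163); (343460857, 593);
      (356799493, 3); (370427137, 2); (374464609, 2); (391113221, 17);
      (468314257, 2); (512829841, 2); (556227457, 2); (558469243, 3);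
      (581972453, 97); (622097393, 2); (700678997, 7649);
      (722037941, 17); (725987453, 8017); (736528657, 2);
      (777468073, 17); (858873553, 2); (935792593, 2); (941797777, 2);
      (974190673, 2); (1021622741, 2220919); (1167815521, 2);
      (1218559669, 4463); (1223964437, 17); (1254501329, 2);
      (1350817133, 10193); (1431584941, 1021); (1494955937, 2);
      (1525927009, 2); (1541355797, 17); (1889744821, 17);
      (1949940913, 2); (1961570489, 2857); (1974123953, 2);
      (2268633329, 2); (2559066073, 83761); (2768106433, 2);
      (2790467761, 2); (3011074681, 17); (3058522657, 2);
      (3104713681, 2); (3187388081, 2); (3441771769, 6203);
      (3792127697, 2); (4884847621, 113); (4945353541, 10477);
      (5320336717, 2063); (5578265293, 337); (5658887149, 172801);
      (5776303529, 722037941); (7204316443, 9165797); (7394801569, 2);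
      (7759850221, 3); (7905228953, 991127); (8983832167, 2801);
      (9752630869, 241); (12119298109, 977); (12323087641, 673);
      (12753237037, 241); (13218366277, 15559); (14392317833, 75239);
      (17883452161, 2); (23233706849, 2); (24204612193, 2);
      (24272400197, 69661); (25556768101, 17); (27581372449, 2);
      (29830439921, 2); (32464519513, 1123); (34751966101, 17);
      (35928799729, 2); (43225898659, 7204316443); (43591442429, 193);
      (45144513569, 2); (50673840949, 58453); (53350902641, 2);
      (60276910121, 47137); (60678379933, 9011); (66281498497, 2);
      (68859962617, 2417); (72356471237, 103); (82046254421, 17);
      (83011968817, 2); (87362636233, 2659); (91041964109, 137);
      (99972364781, 17); (133463762737, 2); (133531551553, 2);
      (136014079297, 2); (141130045201, 2); (182321596097, 2);
      (190341967969, 2); (220416491237, 2259199);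
      (220629009101, 93761); (231985335097, 2081); (239735225329, 2);
      (243842017873, 2); (365276494201, 17); (406217377529, 2037689);
      (496229152129, 2); (539939350861, 103); (605679119867, 337);
      (1048164659777, 2); (1052519049877, 514093);
      (1145322825061, 805873); (1267746817541, 97);
      (1285025903041, 2); (1455278223821, 19841); (2026136263429, 17);
      (2117428838233, 239); (2196431308501, 4091); (2265573941461, 3);
      (2434616217281, 2); (2504727814657, 2); (2855921206753, 2);
      (5218735279937, 2); (5757391578641, 2);
      (9145782224597, 1686907); (10315312953493, 36198653);
      (11491797247303, 97139501); (16122373124497, 2);
      (17656084793233, 2); (17740643902517, 4294237);
      (20546156229509, 176123); (24825784490417, 2);
      (25607964820961, 2); (29738570679793, 2); (34857714968897, 2);
      (40572574538437, 3); (43644426217789, 336357673);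
      (82324334351173, 32575469); (83356258634317, 33169333);
      (91123587677957, 195029); (102445379821831, 43225898659);
      (108140989558681, 23609); (157824082603361, 2);
      (160010143877257, 2741); (192960494051441, 2);
      (346185031289327, 558469243); (1333992334863101, 73951);
      (1655459586381361, 2); (3457622042749267, 82324334351173);
      (3640850324756933, 5776303529); (3988298352751117, 17);
      (4382669950152869, 53350902641); (4718663408317093, 1727051);
      (6158208115809829, 2687); (7704961869232861, 163);
      (7946702646312853, 8983832167); (8684496096371153, 2);
      (14681613197874829, 2696633); (32244044745288737, 2);
      (33886099933106033, 2); (73633690587839209, 278904161);
      (82226532171533377, 2); (126911367545566633, 31013);
      (128191904236188253, 6194921); (142066482414807053, 17);
      (231270445258819013, 113); (305500739256487301, 33458933);
      (333050575433295541, 17); (710782170871822813, 17);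
      (831466699704602681, 182321596097);
      (932899412376059861, 125003); (1299796670778101401, 1370519);
      (1678869838776939961, 605679119867);
      (2045888202279897221, 12253);
      (2068868423355374441, 133531551553);
      (6151373765077884617, 13488737);
      (10515091046986206917, 9834443); (15326521399539362321, 2);
      (20741630293220408281, 3082543);
      (29003926153637505397, 102445379821831);
      (47081123724039517309, 28256399); (58192123416674120609, 2);
      (85580931017902084997, 11491797247303);
      (171857646012809566969, 3457622042749267);
      (264484004729713012553, 126473);
      (2856068050340702469241, 346185031289327);
      (5286823423551589266953, 39499);
      (227373376637151422694661, 24825784490417);
      (21343584272214654741969759121, 2)]%num.

(** Pairs [(d, p)] with [p] a factor of [4 ^ d + 1], which excludes [2 * n] for
    every odd multiple [n] of [d]. *)
Definition exponent_factors : seq (N * N) :=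
  [:: (7, 113); (11, 2113); (19, 525313); (25, 8101); (27, 246241);
      (29, 107367629); (37, 593); (39, 1249); (43, 500177);
      (45, 54001); (47, 3761); (53, 15358129); (59, 157649);
      (65, 108140989558681); (67, 2559066073); (71, 148587949);
      (73, 9929); (83, 13063537); (95, 54721); (101, 5218735279937);
      (109, 171857646012809566969); (115, 1021622741); (127, 26417);
      (131, 269665073); (139, 1408349); (145, 168781); (155, 37201);
      (157, 2790467761); (183, 5080081); (201, 3217); (207, 3313);
      (223, 95768689); (263, 99972364781); (269, 8609); (279, 140617);
      (299, 20333); (305, 183102481); (311, 21149); (313, 42569);
      (347, 5575597); (359, 585889); (383, 111650629); (397, 25409);
      (403, 25793); (569, 257189); (571, 2384497); (597, 121789);
      (599, 86257); (739, 170756297); (743, 260683037);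
      (761, 1567661); (983, 43644426217789); (985, 15761);
      (991, 47569); (993, 13302229); (997, 7905228953);
      (1013, 264484004729713012553); (1019, 207877);
      (1033, 622097393); (1039, 47577889); (1049, 83011968817);
      (1051, 1513441); (1061, 49459577); (1063, 119057);
      (1567, 75217); (1571, 127489793); (1597, 19362029);
      (1607, 668513); (1609, 5702297); (1657, 26513); (1663, 266081);
      (1789, 5796361); (1801, 23233706849); (1811, 8684496096371153);
      (1823, 58337); (1847, 88657); (1861, 1949940913);
      (1867, 4382669950152869); (1901, 4884847621); (2531, 4910141);
      (2539, 284369); (2617, 125617); (2671, 42737); (2683, 30468149);
      (2707, 62629153); (2711, 86753); (2729, 5658887149);
      (2731, 305873); (2777, 2288249); (4507, 5534597);
      (4517, 1961570489); (4519, 21343584272214654741969759121);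
      (4533, 136014079297); (4537, 2939977); (4549, 17795689);
      (4597, 142543777); (4603, 10515091046986206917);
      (4621, 64120997); (4643, 15326521399539362321); (4647, 74353);
      (4649, 6638773); (4651, 86396977); (4677, 299329);
      (4703, 150497); (4723, 5459789); (4729, 529649);
      (4733, 1350817133); (4787, 325517); (4789, 187077497);
      (4839, 2167873); (4857, 8392897); (4877, 3511441);
      (4881, 780961); (4889, 1799153); (4937, 631937);
      (4969, 1749089); (4987, 1037297); (7509, 2196431308501);
      (7541, 23769233); (7547, 603761); (7589, 516053);
      (7615, 852881); (7621, 20119441);
      (7639, 2856068050340702469241); (7643, 611441); (7647, 734113);
      (7671, 76648633); (7741, 30468577); (7757, 82046254421);
      (7759, 294407497); (7789, 5826173); (7853, 1455278223821);
      (7863, 18745393); (7895, 13642561); (7919, 24272400197);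
      (7927, 9797773); (7933, 710782170871822813); (7941, 18486649);
      (7951, 127217); (8009, 544613); (8011, 2050817);
      (8039, 163866977); (8053, 24204612193); (8097, 12119298109);
      (8117, 4545521); (8157, 8385397); (8171, 32244044745288737);
      (8233, 3951841); (8237, 33886099933106033); (8243, 14804429);
      (8247, 527809); (8293, 132689); (8311, 2127617);
      (8329, 133463762737); (22511, 3640850324756933);
      (22521, 935792593); (22531, 243842017873); (22537, 360593);
      (22541, 2885249); (22549, 1299796670778101401); (22551, 360817);
      (22573, 932899412376059861); (22577, 250333777);
      (22587, 17656084793233); (22613, 5578265293); (22619, 8323793);
      (22621, 1085809); (22633, 2768106433); (22637, 468314257);
      (22639, 725987453); (22651, 305500739256487301);
      (22683, 68859962617); (22689, 87398029); (22719, 3058522657);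
      (22723, 14815397); (22727, 32464519513);
      (22731, 40572574538437); (22741, 43662721);
      (22751, 3988298352751117); (22753, 1218559669);
      (22773, 3643681); (22777, 9293017); (22789, 288326429);
      (22801, 34857714968897); (22807, 2265573941461);
      (22809, 68244529); (22821, 365137); (22835, 60276910121);
      (22837, 142066482414807053); (22859, 25607964820961);
      (22861, 118785757); (22867, 6158208115809829);
      (22871, 1223964437); (22877, 58192123416674120609);
      (22887, 3295729); (22901, 700678997); (22915, 391113221);
      (22937, 1100977); (22943, 7704961869232861); (22963, 137778001);
      (22973, 9145782224597); (23003, 1525927009); (23007, 19509937);
      (23027, 227373376637151422694661); (23059, 1541355797);
      (23061, 60678379933); (23083, 7755889);
      (23099, 1678869838776939961); (23109, 231985335097);
      (23117, 496229152129); (23119, 3441771769); (23143, 308635049);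
      (23147, 1573997); (23151, 34751966101);
      (23159, 47081123724039517309); (23169, 12753237037);
      (23185, 76788721); (23203, 87362636233); (23209, 72356471237);
      (23211, 356799493); (23213, 742817); (23231, 29738570679793);
      (23251, 102676417); (23269, 83356258634317); (23281, 372497);
      (23311, 14681613197874829); (23319, 1167815521);
      (23321, 1267746817541); (23327, 4105553); (23343, 373489);
      (23369, 1431584941); (23371, 8226593); (23383, 2244769);
      (23393, 5614321); (23395, 374321); (23417, 539939350861);
      (23447, 19883057); (23455, 375281); (23459, 1126033);
      (23467, 1501889); (23493, 7893649); (23497, 1974123953);
      (23531, 220629009101); (23539, 35928799729);
      (23549, 239735225329); (23557, 2268633329);
      (23561, 190341967969); (23581, 377297);
      (23593, 29003926153637505397); (23599, 13218366277);
      (23601, 4945353541); (23627, 82226532171533377);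
      (23629, 1134193); (23631, 7394801569); (23637, 7563841);
      (23649, 941797777); (23663, 16122373124497);
      (23687, 1145322825061); (23697, 9478801); (23703, 7584961);
      (23721, 370427137); (23743, 379889); (23747, 10315312953493);
      (23755, 192960494051441); (23763, 3802081);
      (23773, 128191904236188253); (23789, 761249);
      (23795, 512829841); (23803, 1523393);
      (23819, 2045888202279897221); (23827, 9244877);
      (23831, 7759850221); (23833, 289427953); (23847, 858873553);
      (23879, 5320336717); (23893, 20741630293220408281);
      (23899, 1529537); (23909, 141130045201); (23911, 14392317833);
      (23915, 1913201); (23917, 220706077); (23965, 3104713681);
      (23967, 5368609); (23979, 25705489); (23995, 157824082603361);
      (24019, 17740643902517); (24029, 4613569);
      (24067, 2434616217281); (24071, 73633690587839209);
      (24077, 29830439921); (24081, 50673840949);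
      (24083, 365276494201); (24091, 4718663408317093);
      (24093, 12323087641); (24119, 1157713); (24121, 777468073);
      (24133, 343460857); (24137, 91041964109); (24151, 216779377);
      (24155, 1285025903041); (24179, 85580931017902084997);
      (24197, 3011074681); (24203, 43591442429);
      (24223, 1333992334863101); (24231, 313549141);
      (24239, 91123587677957); (24261, 9752630869);
      (24281, 333050575433295541); (24317, 160010143877257);
      (24369, 736528657); (24371, 779873); (24373, 1052519049877);
      (24391, 220416491237); (24397, 5286823423551589266953);
      (24401, 39529621); (24407, 175339889); (24421, 1494955937);
      (24427, 1172497); (24439, 2855921206753); (24441, 782113);
      (24443, 21607613); (24469, 2026136263429); (24473, 66281498497);
      (24503, 19994449); (24509, 6151373765077884617);
      (24515, 2068868423355374441); (24533, 27581372449);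
      (24537, 392593); (24551, 556227457); (24571, 7946702646312853);
      (24573, 786337); (24587, 1048164659777); (24589, 581972453);
      (24611, 45185797); (24623, 126911367545566633);
      (24631, 1182289); (24641, 17883452161); (24653, 20546156229509);
      (24657, 5128657); (24659, 45144513569); (24683, 1974641);
      (24697, 231270445258819013); (24707, 2117428838233);
      (24709, 47441281); (24749, 1655459586381361); (24755, 36835441);
      (24767, 102733517); (24781, 974190673);
      (24785, 831466699704602681); (24793, 3187388081);
      (24799, 51185137); (24807, 2381473); (24835, 1889744821);
      (24841, 3792127697); (24851, 5964241); (24859, 35498653);
      (24861, 33810961); (24873, 2504727814657);
      (24877, 5757391578641); (24883, 1254501329); (24887, 22000109);
      (24903, 290169757); (24919, 406217377529); (24931, 25556768101);
      (24943, 22548473); (24951, 374464609); (24967, 399473)]%num.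

(** The list [candidates] in binary, where comparisons are cheap. *)
Definition binary_candidates : seq N :=
  [:: 45142; 45286; 45394; 45434; 45478; 45566; 45622; 45706; 45842; 46022;
      46042; 46058; 46394; 46454; 46630; 46714; 46862; 47206; 47246;
      47342; 47378; 47438; 47506; 47858; 47962; 47986; 48086; 48218;
      48338; 48362; 48838; 49354; 49466; 49694; 49834; 49906; 49958;
      49978]%num.

Lemma chain_steps_ok : steps_ok [::] chain_steps.
Proof. by vm_compute. Qed.

Lemma exponent_factors_ok :
  all (factor_ok [seq s.1 | s <- chain_steps]) exponent_factors.
Proof. by vm_compute. Qed.

Lemma candidates_or_excluded :
  all (fun n => has (N.eqb (2 * n)) binary_candidates
                || excluded [seq s.1 | s <- chain_steps] exponent_factors n)
      [seq (2 * 11250 + 1 + 2 * N.of_nat j)%num | j <- iota 0 1250].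
Proof. by vm_compute. Qed.

Theorem theorem20 (m : nat) :
  Heven m -> 45000 < m <= 50000 -> m \in candidates.
Proof.
have <- : [seq N.to_nat c | c <- binary_candidates] = candidates.
  by apply/eqP; vm_compute.
(* Boolean equality is evaluated here because conversion between unary
   numerals of this size overflows the stack. *)
have lower : 45000 = 4 * N.to_nat 11250 by apply/eqP; vm_compute.
have upper : 50000 = 4 * N.to_nat 11250 + 5000 by apply/eqP; vm_compute.
move=> Hm; rewrite upper lower.
exact (@Heven_mem_of_tables 11250 chain_steps exponent_factors
  binary_candidates chain_steps_ok exponent_factors_ok
  candidates_or_excluded m Hm).
Qed.
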